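(* Let $m\ge 2$, $n\ge 1$, and let $P_1,\dots,P_n\in\mathbb{R}^{m\times m}$ be stochastic reversible matrices with stationary distributions $\mu_1,\dots,\mu_n$, respectively. Denote their product by $P^{\mathrm{prod}}_n=\prod_{i=1}^nP_i=P_1P_2\cdots P_n$. Then $$|\lambda_2(P^{\mathrm{prod}}_n)| \leq \left(\prod_{i=1}^{n}|\lambda_2(P_i)|\right)\left(\prod_{i=2}^{n}\max_j\frac{\mu_{i-1}[j]}{\mu_i[j]}\right)\max_j\frac{\mu_n[j]}{\mu_1[j]}.$$
   Context: For a vector $x$, $D(x)$ is the diagonal matrix with $x$ on its diagonal, $D^{-1}(x)=(D(x))^{-1}$, and $x[j]$ is the $j$-th entry of $x$. A square matrix is stochastic if its entries are non-negative and each row sums to $1$. A stochastic matrix $P$ with stationary distribution $\mu$ (a probability vector with $\mu^\top P=\mu^\top$, all of whose entries are strictly positive so that $D(\mu)$ is invertible) is called reversible if $P=D^{-1}(\mu)P^\top D(\mu)$; the $\mu_i$ in the claim are the stationary distributions for which this identity holds. For a square matrix $A$, $\lambda_1(A),\lambda_2(A),\dots$ are its (complex) eigenvalues listed with algebraic multiplicity in order of non-increasing absolute value, so $\lambda_2(A)$ is the second largest in modulus. *)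

(* Defs.v *)
From mathcomp Require Import all_boot all_order all_algebra.
From mathcomp Require Import reals complex.

Set Implicit Arguments.
Unset Strict Implicit.
Unset Printing Implicit Defensive.

Import Order.TTheory GRing.Theory Num.Theory.
Local Open Scope ring_scope.

Section Markov.
Variables (R : realType) (m : nat).
Implicit Types (P : 'M[R]_m) (x mu : 'cV[R]_m).

Definition stochastic P : Prop :=
  (forall i j, 0 <= P i j) /\ (forall i, \sum_j P i j = 1).

Definition Dmx x : 'M[R]_m := diag_mx x^T.

(* Strict positivity is part of the definition: it makes [Dmx mu] invertible.
   Uniqueness of the stationary distribution is not required. *)
Definition stationary_distribution P mu : Prop :=
  [/\ forall j, 0 < mu j 0, \sum_j mu j 0 = 1 & mu^T *m P = mu^T].

Definition reversible P mu : Prop :=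
  P = invmx (Dmx mu) *m P^T *m Dmx mu.

(* The base value 0 of the big maximum is immaterial when [0 < m] and both
   vectors are positive. *)
Definition max_ratio x mu : R := \big[Num.max/0]_(j < m) (x j 0 / mu j 0).

End Markov.

Section Eigenvalues.
Variables (C : numClosedFieldType) (m : nat).
Implicit Type A : 'M[C]_m.

(* The roots of the characteristic polynomial, with multiplicity, by
   non-increasing modulus. Ties are broken arbitrarily, which does not affect
   the moduli, see [norm_eigval_uniq]. *)
Definition eigenvalues A : seq C :=
  sort (fun x y => `|y| <= `|x|)
       (sval (closed_field_poly_normal (char_poly A))).

(* [k] counts from 1. *)
Definition eigval (k : nat) A : C := nth 0 (eigenvalues A) k.-1.

Lemma char_poly_eigenvalues A :
  char_poly A = \prod_(z <- eigenvalues A) ('X - z%:P).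
Proof.
rewrite /eigenvalues; case: closed_field_poly_normal => r /= Dp.
rewrite (perm_big r) ?perm_sort //=.
by rewrite {1}Dp (eqP (char_poly_monic A)) scale1r.
Qed.

Lemma size_eigenvalues A : size (eigenvalues A) = m.
Proof.
by have := size_char_poly A; rewrite char_poly_eigenvalues size_prod_XsubC => -[].
Qed.

Lemma eigenvalues_sorted A :
  sorted (fun x y => `|y| <= `|x|) (eigenvalues A).
Proof.
by apply: sort_sorted => x y; apply: real_leVge; rewrite ger0_real.
Qed.

Lemma norm_eigval_uniq A (s : seq C) (k : nat) :
  char_poly A = \prod_(z <- s) ('X - z%:P) ->
  sorted (fun x y => `|y| <= `|x|) s ->
  `|eigval k A| = `|nth 0 s k.-1|.
Proof.
move=> Ds s_sorted.
have perm_s : perm_eq (eigenvalues A) s.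
  by apply: prod_XsubC_eq; rewrite -Ds -char_poly_eigenvalues.
have eq_norms : map Num.norm (eigenvalues A) = map Num.norm s.
  apply: (@sorted_eq _ >=%O); rewrite ?sorted_map ?eigenvalues_sorted //.
  - by move=> x y z yx zx; apply: le_trans zx yx.
  - by move=> x y /andP[/= yx xy]; apply/le_anti/andP.
  - exact: perm_map.
have norm_nth t : `|nth 0 t k.-1| = nth 0 (map Num.norm t) k.-1 :> C.
  have [lt_k|le_k] := ltnP k.-1 (size t); first by rewrite (nth_map 0).
  by rewrite !nth_default ?size_map ?normr0.
by rewrite /eigval !norm_nth eq_norms.
Qed.

End Eigenvalues.

Definition abs_eigval (R : realType) (m k : nat) (A : 'M[R]_m) : R :=
  ComplexField.Normc.normc (eigval k (map_mx (real_complex R) A)).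

(* Main.v *)
Require Import Defs.
From mathcomp Require Import all_boot all_order all_algebra.
From mathcomp Require Import reals complex ring.

Set Implicit Arguments.
Unset Strict Implicit.

Import Order.TTheory GRing.Theory Num.Theory.
Local Open Scope ring_scope.

(* Let [Var_w x] be the variance of the vector [x] under the distribution [w],
   that is, the squared distance from [x] to the constant vectors in the norm
   of l^2(w). A reversible [P] is self-adjoint in l^2(mu), so [P] contracts
   [Var_mu] by the factor [|lambda_2(P)|^2]; being a minimum over constants,
   [Var_mu] is at most [max_j (mu[j] / nu[j])] times [Var_nu]. Alternating the
   two bounds along the product [A = P_1 ... P_n] gives [Var_mu1 (A x) <= K *
   Var_mu1 x], so every eigenvalue of [A] on the quotient by the constants has
   squared modulus at most [K]. The ratios enter [K] to the first power, and
   they are at least 1, so [K] is below the square of the claimed bound.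
   The quotient is replaced by the deflation [A - 1 mu^T], whose spectrum is
   that of [A] with one eigenvalue 1 turned into 0. *)

(** * Rank-one deflation and characteristic polynomials *)

Section Deflation.

(** Matrix determinant lemma: eliminating either block column of [M] gives its determinant in two
    ways. The factor [a] on the left avoids dividing by [a]. *)
Lemma det_scalar_add_rank1 (R : comNzRingType) (m : nat) (a : R)
    (u : 'cV[R]_m) (v : 'rV[R]_m) :
  a * \det (a%:M + u *m v) = a ^+ m * (a + (v *m u) 0 0).
Proof.
pose M := block_mx (1%:M : 'M_1) (- v) u a%:M.
have detM : \det M = \det (a%:M + u *m v).
  have : \det (block_mx 1%:M 0 (- u) 1%:M *m M) = \det M.
    by rewrite det_mulmx det_lblock !det1 !mul1r.
  rewrite mulmx_block !mul0mx !mul1mx !addr0 mulmx1 mulNmx mulmxN opprK.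
  by rewrite addNr det_ublock det1 mul1r addrC => <-.
have : \det (block_mx a%:M v 0 1%:M *m M) = a * \det M.
  by rewrite det_mulmx det_ublock det1 mulr1 det_scalar1.
rewrite mulmx_block !mul0mx !mul1mx !add0r mulmx1 mul_scalar_mx mul_mx_scalar.
rewrite scalerN addNr det_lblock det_scalar det_mx11 !mxE detM => <-.
by rewrite mulrC eqxx mulr1n.
Qed.

(** As [(X - A) u = (X - 1) u], one has [(X - A) (X - 1 + u v) = (X - 1) (X - A + u v)]. Take
    determinants and cancel [(X - 1) ^ m]. *)
Lemma char_poly_deflation (R : idomainType) (m : nat) (A : 'M[R]_m)
    (u : 'cV[R]_m) (v : 'rV[R]_m) :
  A *m u = u -> (v *m u) 0 0 = 1 ->
  'X * char_poly A = ('X - 1) * char_poly (A - u *m v).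
Proof.
move=> Au vu.
pose u' := map_mx polyC u; pose v' := map_mx polyC v.
have Eu : char_poly_mx A *m u' = ('X - 1) *: u'.
  rewrite mulmxBl -map_mxM Au mul_scalar_mx scalerBl scale1r //.
have vu' : (v' *m u') 0 0 = 1 by rewrite -map_mxM mxE vu.
have E : char_poly_mx A *m (('X - 1)%:M + u' *m v')
       = ('X - 1)%:M *m char_poly_mx (A - u *m v).
  rewrite mulmxDr mulmxA Eu mul_mx_scalar mul_scalar_mx -scalemxAl -scalerDr.
  congr (_ *: _); rewrite /char_poly_mx map_mxB map_mxM opprB addrA.
  by rewrite addrAC.
have := det_scalar_add_rank1 ('X - 1) u' v'; rewrite vu' subrK => Ed.
have /(congr1 (fun z => ('X - 1) * z)) := congr1 determinant E.
rewrite !det_mulmx det_scalar mulrCA Ed => E'.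
have X1_neq0 : ('X - 1 : {poly R}) != 0 by rewrite -polyC1 polyXsubC_eq0.
apply: (mulfI (expf_neq0 m X1_neq0)); rewrite [RHS]mulrCA -[RHS]E'.
by rewrite mulrA [LHS]mulrC.
Qed.

End Deflation.

(** * Spectrum of a matrix against that of its deflation *)

Section Spectrum.
Variables (C : numClosedFieldType) (m : nat).
Implicit Types (A B : 'M[C]_m) (x : 'cV[C]_m).

Lemma char_poly_trmx (R : comNzRingType) (A : 'M[R]_m) :
  char_poly A^T = char_poly A.
Proof.
rewrite /char_poly -[RHS]det_tr /char_poly_mx linearB /= tr_scalar_mx.
by rewrite map_trmx.
Qed.

Lemma mem_eigenvalues A a : (a \in eigenvalues A) = eigenvalue A a.
Proof.
by rewrite eigenvalue_root_char char_poly_eigenvalues root_prod_XsubC.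
Qed.

(** [eigenvalue] refers to row vectors; transposition, which keeps the characteristic polynomial,
    gives a column. *)
Lemma right_eigenvectorP A a :
  eigenvalue A a -> exists2 x : 'cV[C]_m, A *m x = a *: x & x != 0.
Proof.
rewrite eigenvalue_root_char -char_poly_trmx -eigenvalue_root_char.
case/eigenvalueP=> v vA v0; exists v^T; last by rewrite trmx_eq0.
by rewrite -[A]trmxK -trmx_mul vA linearZ.
Qed.

(** Unit row sums make [v |-> v A] non-expanding in the l^1 norm. *)
Lemma stochastic_eigenvalue_le1 A a :
  (forall i j, 0 <= A i j) -> (forall i, \sum_j A i j = 1) ->
  eigenvalue A a -> `|a| <= 1.
Proof.
move=> A0 A1 /eigenvalueP[v vA v0].
have [j vj] : exists j, v 0 j != 0.
  apply/existsP; apply: contraNT v0; rewrite negb_exists => /forallP v0.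
  by apply/eqP/rowP=> j; rewrite mxE; apply/eqP; rewrite -[_ == _]negbK.
have s0 : 0 < \sum_j `|v 0 j|.
  rewrite (bigD1 j) //= ltr_pwDl ?normr_gt0 //.
  by apply: sumr_ge0 => i _; apply: normr_ge0.
rewrite -(ler_pM2r s0) mul1r mulr_sumr.
have -> : \sum_i `|v 0 i| = \sum_i \sum_j `|v 0 j| * A j i.
  by rewrite exchange_big; apply: eq_bigr => i _; rewrite -mulr_sumr A1 mulr1.
apply: ler_sum => i _; rewrite -normrM.
have -> : a * v 0 i = (v *m A) 0 i by rewrite vA mxE.
rewrite mxE (le_trans (ler_norm_sum _ _ _)) //.
by apply: ler_sum => k _; rewrite normrM (ger0_norm (A0 _ _)).
Qed.

Lemma perm_eigenvalues_deflation A (u : 'cV[C]_m) (v : 'rV[C]_m) :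
  A *m u = u -> (v *m u) 0 0 = 1 ->
  perm_eq (0 :: eigenvalues A) (1 :: eigenvalues (A - u *m v)).
Proof.
move=> Au vu; apply: prod_XsubC_eq; rewrite !big_cons subr0 polyC1.
by rewrite -!char_poly_eigenvalues (char_poly_deflation Au vu).
Qed.

Lemma eigenvaluesE A : (2 <= m)%N ->
  exists t, eigenvalues A = [:: eigval 1 A, eigval 2 A & t].
Proof.
rewrite -{1}(size_eigenvalues A) /eigval.
by case: eigenvalues => [|a [|b t]] //= _; exists t.
Qed.

Lemma norm_eigval_sorted A : (2 <= m)%N ->
  `|eigval 2 A| <= `|eigval 1 A|
  /\ forall t, eigenvalues A = [:: eigval 1 A, eigval 2 A & t] ->
     forall b, b \in t -> `|b| <= `|eigval 2 A|.
Proof.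
move=> m2; have [t Et] := eigenvaluesE A m2.
have := eigenvalues_sorted A; rewrite Et /= => /andP[-> s_t].
split=> // _ [<-] b bt.
have tr : transitive (fun x y : C => `|y| <= `|x|).
  by move=> x y z yx zx; apply: le_trans zx yx.
by move: s_t; rewrite (path_sortedE tr) => /andP[/allP/(_ b bt)].
Qed.

(* Were [`|eigval 2 A|] larger, two members of [0 :: eigenvalues A] would exceed
   the bound, but only the head of the other list can. *)
Lemma norm_eigval2_le A (u : 'cV[C]_m) (v : 'rV[C]_m) (k : C) :
  (2 <= m)%N -> A *m u = u -> (v *m u) 0 0 = 1 ->
  (forall b, eigenvalue (A - u *m v) b -> `|b| <= k) ->
  `|eigval 2 A| <= k.
Proof.
move=> m2 Au vu le_k.
have [t Et] := eigenvaluesE A m2.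
have [le21 _] := norm_eigval_sorted A m2.
have size_B := size_eigenvalues (A - u *m v).
(* The order of [C] is partial, so negating [<=] requires [k] real; [k] dominates the modulus of
   some eigenvalue since [m] is positive. *)
have k0 : k \is Num.real.
  case EB: (eigenvalues (A - u *m v)) size_B m2 => [|b s]; first by move=> <-.
  move=> _ _.
  have /le_k b_le : eigenvalue (A - u *m v) b.
    by rewrite -mem_eigenvalues EB mem_head.
  by rewrite ger0_real // (le_trans _ b_le).
rewrite real_leNgt //; apply/negP => lt_k.
have /permP/(_ (fun z => k < `|z|)) := perm_eigenvalues_deflation Au vu.
rewrite /= Et /= lt_k (lt_le_trans lt_k le21).
have /eqP -> : count (fun z => k < `|z|) (eigenvalues (A - u *m v)) == 0%N.
  rewrite -leqn0 leqNgt -has_count; apply/hasPn => b.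
  by rewrite mem_eigenvalues => /le_k b_le; rewrite -real_leNgt.
by case: (_ < _) (_ < _) => [] [].
Qed.

(** Otherwise [|eigval 2 A| < |b| <= 1], so both 1 and [b] exceed [|eigval 2 A|] in the deflated
    list, while only [eigval 1 A] can in the other. *)
Lemma deflated_eigenvalue_le A (u : 'cV[C]_m) (v : 'rV[C]_m) b :
  (2 <= m)%N -> A *m u = u -> (v *m u) 0 0 = 1 ->
  (forall a, eigenvalue A a -> `|a| <= 1) ->
  eigenvalue (A - u *m v) b -> `|b| <= `|eigval 2 A|.
Proof.
move=> m2 Au vu le1; rewrite -mem_eigenvalues => bB.
have [t Et] := eigenvaluesE A m2.
have [_ /(_ t Et) le_t] := norm_eigval_sorted A m2.
have pE := perm_eigenvalues_deflation Au vu.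
rewrite real_leNgt ?normr_real //; apply/negP => lt_b.
have b1 : `|b| <= 1.
  have : b \in 0 :: eigenvalues A by rewrite (perm_mem pE) inE bB orbT.
  rewrite inE => /predU1P[->|]; rewrite ?normr0 ?ler01 //.
  by rewrite mem_eigenvalues => /le1.
have /permP/(_ (fun z => `|eigval 2 A| < `|z|)) := pE.
rewrite Et /= normr0 normr1 ltxx (lt_le_trans lt_b b1) normr_lt0 /=.
have /eqP -> : count (fun z => `|eigval 2 A| < `|z|) t == 0%N.
  rewrite -leqn0 leqNgt -has_count; apply/hasPn => c /le_t c_le.
  by rewrite -real_leNgt ?normr_real.
rewrite !addn0 => /eqP; apply/negP; rewrite neq_ltn; apply/orP; left.
rewrite add0n add1n ltnS (leq_trans (leq_b1 _)) // -has_count.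
by apply/hasP; exists b.
Qed.

End Spectrum.

(** * Weighted norm, mean and variance *)

Section Variance.
Variables (C : numClosedFieldType) (m : nat).
Implicit Types (A P : 'M[C]_m) (x w : 'cV[C]_m).

Definition wnorm2 w x : C := \sum_j w j 0 * `|x j 0| ^+ 2.
Definition wmean w x : C := (w^T *m x) 0 0.
Definition wvar w x : C := wnorm2 w (x - const_mx (wmean w x)).

Definition positive_distribution w :=
  (forall j, 0 < w j 0) /\ \sum_j w j 0 = 1.

Lemma wnorm2_ge0 w x : (forall j, 0 < w j 0) -> 0 <= wnorm2 w x.
Proof.
move=> w0; apply: sumr_ge0 => j _.
by rewrite mulr_ge0 ?exprn_ge0 // ltW.
Qed.

Lemma wvar_ge0 w x : (forall j, 0 < w j 0) -> 0 <= wvar w x.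
Proof. exact: wnorm2_ge0. Qed.

Lemma wnorm2_eq0 w x : (forall j, 0 < w j 0) -> wnorm2 w x = 0 -> x = 0.
Proof.
move=> w0 x0; apply/colP => j; rewrite mxE; apply/eqP.
have term_ge0 i : true -> 0 <= w i 0 * `|x i 0| ^+ 2.
  by rewrite mulr_ge0 ?exprn_ge0 // ltW.
move/eqP: (psumr_eq0P term_ge0 x0 (i := j) isT).
by rewrite mulf_eq0 gt_eqF //= sqrf_eq0 normr_eq0.
Qed.

Lemma wnorm2Z w a x : wnorm2 w (a *: x) = `|a| ^+ 2 * wnorm2 w x.
Proof.
rewrite mulr_sumr; apply: eq_bigr => j _.
by rewrite mxE normrM exprMn mulrCA.
Qed.

Lemma wmeanE w x : wmean w x = \sum_j w j 0 * x j 0.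
Proof. by rewrite /wmean mxE; apply: eq_bigr => j _; rewrite mxE. Qed.

Lemma wvarZ w a x : wvar w (a *: x) = `|a| ^+ 2 * wvar w x.
Proof.
rewrite /wvar -wnorm2Z scalerBr; congr (wnorm2 _ (_ - _)).
by apply/colP => j; rewrite /wmean -scalemxAr !mxE.
Qed.

Lemma wmeanBc w c x :
  positive_distribution w -> wmean w (x - const_mx c) = wmean w x - c.
Proof.
move=> [_ w1]; rewrite !wmeanE; under eq_bigr do rewrite !mxE mulrBr.
by rewrite sumrB -mulr_suml w1 mul1r.
Qed.

Lemma wvarBc w c x :
  positive_distribution w -> wvar w (x - const_mx c) = wvar w x.
Proof.
move=> dw; rewrite /wvar wmeanBc //; congr wnorm2; apply/colP => j.
by rewrite !mxE opprB addrA subrK.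
Qed.

(** Pythagoras: [x - c] is the centred vector [y] plus the constant [d], and these are orthogonal in
    l^2(w). *)
Lemma wvar_le w c x :
  positive_distribution w -> wvar w x <= wnorm2 w (x - const_mx c).
Proof.
move=> dw; have [w0 w1] := dw.
pose d := wmean w x - c.
pose y := x - const_mx (wmean w x).
have sy : \sum_j w j 0 * y j 0 = 0.
  by rewrite -wmeanE wmeanBc // subrr.
have sy' : \sum_j w j 0 * (y j 0)^* = 0.
  have := congr1 Num.conj sy; rewrite conjC0 rmorph_sum /= => cj0; rewrite -[RHS]cj0.
  apply: eq_bigr => j _.
  by rewrite rmorphM /= (CrealP (gtr0_real (w0 j))).
suff -> : wnorm2 w (x - const_mx c) = wvar w x + `|d| ^+ 2.
  by rewrite lerDl exprn_ge0.
rewrite /wvar -/y.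
transitivity (\sum_j (w j 0 * `|y j 0| ^+ 2 + w j 0 * `|d| ^+ 2
               + (w j 0 * y j 0 * d^* + w j 0 * (y j 0)^* * d))).
  apply: eq_bigr => j _.
  have -> : (x - const_mx c) j 0 = y j 0 + d by rewrite !mxE addrA subrK.
  by rewrite !normCK rmorphD /=; ring.
by rewrite !big_split /= -!mulr_suml sy sy' w1 !mul0r !addr0 mul1r.
Qed.

(** Centring [x] at its [w']-mean on both sides allows a termwise comparison. *)
Lemma wvar_change w w' (r : C) x :
  positive_distribution w -> (forall j, w j 0 <= r * w' j 0) ->
  wvar w x <= r * wvar w' x.
Proof.
move=> dw le_r; apply: le_trans (wvar_le (wmean w' x) _ dw) _.
rewrite mulr_sumr; apply: ler_sum => j _.
by rewrite mulrA ler_wpM2r ?exprn_ge0.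
Qed.

Lemma mulmx_const1 w x :
  (const_mx 1 : 'cV[C]_m) *m (w^T *m x) = const_mx (wmean w x).
Proof. by apply/colP => j; rewrite /wmean mxE big_ord1 !mxE mul1r. Qed.

Lemma const_mxZ (c : C) : const_mx c = c *: const_mx 1 :> 'cV[C]_m.
Proof. by apply/colP => j; rewrite !mxE mulr1. Qed.

(* An eigenvector of the deflation with zero variance is constant, hence killed
   by the deflation. *)
Lemma deflated_eigenvalue_wvar A w (k a : C) :
  A *m const_mx 1 = const_mx 1 :> 'cV_m -> positive_distribution w ->
  0 <= k -> (forall x, wvar w (A *m x) <= k ^+ 2 * wvar w x) ->
  eigenvalue (A - const_mx 1 *m w^T) a -> `|a| <= k.
Proof.
move=> A1 dw k0 le_k /right_eigenvectorP[x Ax x0].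
have [w0 w1] := dw.
rewrite mulmxBl -mulmxA mulmx_const1 in Ax.
(* [a *: x] and [A *m x] differ by a constant, which the variance ignores. *)
have: `|a| ^+ 2 * wvar w x <= k ^+ 2 * wvar w x.
  by rewrite -wvarZ -Ax wvarBc.
have [vx|] := eqVneq (wvar w x) 0; last first.
  move=> v_neq0; rewrite ler_pM2r ?lt_def ?v_neq0 ?wvar_ge0 //.
  by rewrite ler_sqr ?nnegrE.
move=> _; have /subr0_eq xc := wnorm2_eq0 w0 vx.
move: Ax; rewrite {1}xc const_mxZ -scalemxAr A1 subrr => /esym/eqP.
by rewrite scaler_eq0 (negPf x0) orbF => /eqP ->; rewrite normr0.
Qed.

End Variance.

(** * Contraction of the variance by a reversible matrix *)

Section Contraction.
Variables (C : numClosedFieldType) (m : nat).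
Local Open Scope sesquilinear_scope.

Lemma wnorm2_dotmx (x : 'cV[C]_m) : wnorm2 (const_mx 1) x = (x^t* *m x) 0 0.
Proof.
by rewrite mxE; apply: eq_bigr => j _; rewrite !mxE mul1r normCK mulrC.
Qed.

Lemma wnorm2_unitary (U : 'M[C]_m) (x : 'cV[C]_m) :
  U \is unitarymx -> wnorm2 (const_mx 1) (U *m x) = wnorm2 (const_mx 1) x.
Proof.
move=> uU; rewrite !wnorm2_dotmx trmx_mul map_mxM mulmxA -[in LHS](mulmxA _ _ U).
by rewrite -invmx_unitary // mulVmx ?unitarymx_unit // mulmx1.
Qed.

(** By the spectral theorem, [S] scales each coordinate in a unitary eigenbasis by an eigenvalue. *)
Lemma hermitian_contraction (S : 'M[C]_m) (k : C) (x : 'cV[C]_m) :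
  S^t* = S -> 0 <= k -> (forall a, eigenvalue S a -> `|a| <= k) ->
  wnorm2 (const_mx 1) (S *m x) <= k ^+ 2 * wnorm2 (const_mx 1) x.
Proof.
move=> hS k0 le_k.
have nS : S \is normalmx by apply/normalmxP; rewrite hS.
have uU := spectral_unitarymx S; have U_unit := spectral_unit S.
have/orthomx_spectralP := nS.
set U := spectralmx S in uU U_unit *; set d := spectral_diag S => ES.
have US : U *m S = diag_mx d *m U by rewrite [in LHS]ES !mulmxA mulmxV ?mul1mx.
rewrite -(wnorm2_unitary (S *m x) uU) mulmxA US -mulmxA.
rewrite -(wnorm2_unitary x uU) mulr_sumr; apply: ler_sum => j _.
rewrite mxE !mul1r mul_diag_mx mxE normrM exprMn.
rewrite ler_wpM2r ?exprn_ge0 // ler_sqr ?nnegrE //.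
apply: le_k; apply/eigenvalueP; exists (row j U).
  by rewrite -row_mul US; apply/rowP => i; rewrite mul_diag_mx !mxE.
(* A zero row would contradict the invertibility of [U]. *)
apply/eqP => Uj; have := mulmxK U_unit (delta_mx 0 j : 'rV_m).
rewrite -rowE Uj mul0mx => /rowP/(_ j)/eqP.
by rewrite !mxE !eqxx eq_sym oner_eq0.
Qed.

(* Conjugation by [D(sqrt w)] turns the deflation of [P] into a Hermitian
   matrix and the [w]-weighted norm into the standard one. *)
Lemma reversible_wvar_contraction (P : 'M[C]_m) (w x : 'cV[C]_m) :
  (2 <= m)%N -> positive_distribution w ->
  (forall i j, 0 <= P i j) -> (forall i, \sum_j P i j = 1) ->
  w^T *m P = w^T -> (forall i j, w i 0 * P i j = w j 0 * P j i) ->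
  wvar w (P *m x) <= `|eigval 2 P| ^+ 2 * wvar w x.
Proof.
move=> m2 dw P0 P1 wP balance; have [w0 w1] := dw.
have Pu : P *m const_mx 1 = const_mx 1 :> 'cV_m.
  apply/colP => i; rewrite !mxE -[RHS](P1 i).
  by apply: eq_bigr => j _; rewrite mxE mulr1.
have wu : (w^T *m const_mx 1 : 'M_1) 0 0 = 1.
  by rewrite mxE -[RHS]w1; apply: eq_bigr => j _; rewrite !mxE mulr1.
pose B := P - const_mx 1 *m w^T.
have BE i j : B i j = P i j - w j 0.
  by rewrite !mxE big_ord1 !mxE mul1r.
pose s : 'rV[C]_m := \row_j sqrtC (w j 0).
have s0 j : 0 < s 0 j by rewrite mxE sqrtC_gt0.
have ss j : s 0 j ^+ 2 = w j 0 by rewrite mxE sqrtCK.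
pose D := diag_mx s; pose D' := diag_mx (\row_j (s 0 j)^-1).
have D'D : D' *m D = 1%:M.
  rewrite mulmx_diag -diag_const_mx; congr diag_mx.
  by apply/rowP => j; have := s0 j; rewrite !mxE => sj0; rewrite mulVf ?gt_eqF.
pose S := D *m B *m D'.
have SD : S *m D = D *m B by rewrite -mulmxA D'D mulmx1.
have norm_D y : wnorm2 (const_mx 1) (D *m y) = wnorm2 w y.
  apply: eq_bigr => j _.
  rewrite mul_diag_mx [const_mx _ _ _]mxE mul1r [_ j 0]mxE normrM exprMn.
  by rewrite (gtr0_norm (s0 j)) ss.
have hS : S^t* = S.
  apply/matrixP => i j; rewrite mxE [_^T _ _]mxE.
  have SE i' j' : S i' j' = s 0 i' * (P i' j' - w j' 0) / s 0 j'.
    by rewrite /S mul_mx_diag mxE mul_diag_mx [_ i' j']mxE BE [_ 0 j']mxE.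
  have real_s l : (s 0 l)^* = s 0 l by exact/CrealP/gtr0_real.
  rewrite !SE rmorphM rmorphM fmorphV /= !real_s.
  have -> : (P j i - w i 0)^* = P j i - w i 0.
    by apply/CrealP; rewrite rpredB // ?(ger0_real (P0 _ _)) ?(gtr0_real (w0 _)).
  have si : s 0 i != 0 by rewrite gt_eqF.
  have sj : s 0 j != 0 by rewrite gt_eqF.
  (* Multiplying by [s_i s_j] turns the symmetry of [S] into detailed balance. *)
  apply: (mulfI sj); apply: (mulfI si).
  transitivity (s 0 j ^+ 2 * (P j i - w i 0)); first by field.
  transitivity (s 0 i ^+ 2 * (P i j - w j 0)); last by field.
  by rewrite !ss !mulrBr balance [w i 0 * w j 0]mulrC.
have contr y : wnorm2 w (B *m y) <= `|eigval 2 P| ^+ 2 * wnorm2 w y.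
  rewrite -!norm_D mulmxA -SD -mulmxA; apply: hermitian_contraction => // a.
  case/eigenvalueP => v vS v0.
  apply: (@deflated_eigenvalue_le _ _ P _ w^T a m2 Pu wu).
    by move=> b; apply: stochastic_eigenvalue_le1.
  apply/eigenvalueP; exists (v *m D).
    by rewrite -mulmxA -SD mulmxA vS scalemxAl.
  apply: contraNneq v0 => vD0.
  by rewrite -[v]mulmx1 -(mulmx1C D'D) mulmxA vD0 mul0mx.
have mean_P : wmean w (P *m x) = wmean w x by rewrite /wmean mulmxA wP.
rewrite /wvar mean_P; apply: le_trans (contr _).
(* On the centred vector, of mean 0, [B] acts as [P]. *)
rewrite mulmxBl -mulmxA mulmx_const1 mulmxBr wmeanBc // subrr.
rewrite [const_mx (wmean w x)]const_mxZ -scalemxAr Pu.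
by rewrite [const_mx 0]const_mxZ scale0r subr0.
Qed.

End Contraction.

(** * Bounds on the maximal ratio *)

Section MaxRatio.
Variables (R : realType) (m : nat).
Implicit Types x mu : 'cV[R]_m.

Lemma le_max_ratio x mu j :
  (forall j, 0 < mu j 0) -> x j 0 <= max_ratio x mu * mu j 0.
Proof.
move=> mu0; rewrite -ler_pdivrMr ?mu0 // /max_ratio.
exact: (le_bigmax _ (fun j => x j 0 / mu j 0)).
Qed.

Lemma max_ratio_ge0 x mu : 0 <= max_ratio x mu.
Proof. exact: bigmax_ge_id. Qed.

(** Sum [x_j <= max_ratio x mu * mu_j] over [j]: both masses are 1. *)
Lemma max_ratio_ge1 x mu :
  (forall j, 0 < mu j 0) -> \sum_j x j 0 = 1 -> \sum_j mu j 0 = 1 ->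
  1 <= max_ratio x mu.
Proof.
move=> mu0 x1 mu1; rewrite -[leLHS]x1 -[leRHS]mulr1 -mu1 mulr_sumr.
by apply: ler_sum => j _; apply: le_max_ratio.
Qed.

End MaxRatio.

(** * From real to complex matrices, and the bound along the product *)

Local Notation toC := (map_mx (real_complex _)).

Section Product.
Variables (R : realType) (m : nat).
Implicit Types (P : 'M[R]_m) (mu : 'cV[R]_m).

Lemma norm_eigval (k : nat) P : `|eigval k (toC P)| = (abs_eigval k P)%:C%C.
Proof. by []. Qed.

Lemma positive_distribution_toC P mu :
  stationary_distribution P mu -> positive_distribution (toC mu).
Proof.
move=> [mu0 mu1 _]; split=> [j|]; first by rewrite mxE ltcR.
rewrite -[RHS](rmorph1 (real_complex R)) -mu1 rmorph_sum.
by apply: eq_bigr => j _; rewrite mxE.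
Qed.

(** Detailed balance is reversibility multiplied on the left by [Dmx mu]. *)
Lemma reversible_balance P mu :
  stationary_distribution P mu -> reversible P mu ->
  forall i j, mu i 0 * P i j = mu j 0 * P j i.
Proof.
move=> [mu0 _ _] rev i j.
have D_unit : Dmx mu \in unitmx.
  rewrite unitmxE det_diag unitfE; apply/prodf_neq0 => l _.
  by rewrite mxE gt_eqF.
have /matrixP/(_ i j) : Dmx mu *m P = P^T *m Dmx mu.
  by rewrite [in LHS]rev -mulmxA mulKVmx.
by rewrite mul_diag_mx mul_mx_diag !mxE [RHS]mulrC.
Qed.

Lemma wvar_contraction P mu (x : 'cV[R[i]]_m) :
  (2 <= m)%N -> stochastic P -> stationary_distribution P mu ->
  reversible P mu ->
  wvar (toC mu) (toC P *m x)
    <= (abs_eigval 2 P ^+ 2)%:C%C * wvar (toC mu) x.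
Proof.
move=> m2 [P0 P1] st rev; have dmu := positive_distribution_toC st.
rewrite rmorphXn /= -norm_eigval; apply: reversible_wvar_contraction => //.
- by move=> i j; rewrite mxE lecR.
- move=> i; rewrite -[RHS](rmorph1 (real_complex R)) -(P1 i) rmorph_sum.
  by apply: eq_bigr => j _; rewrite mxE.
- by have [_ _ muP] := st; rewrite map_trmx -map_mxM muP.
- move=> i j; rewrite !mxE -!rmorphM /=; congr (_ %:C%C).
  exact: reversible_balance st rev i j.
Qed.

Lemma wvar_max_ratio P Q mu nu (x : 'cV[R[i]]_m) :
  stationary_distribution P mu -> stationary_distribution Q nu ->
  wvar (toC mu) x <= (max_ratio mu nu)%:C%C * wvar (toC nu) x.
Proof.
move=> stP [nu0 _ _]; apply: wvar_change => [|j].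
  exact: positive_distribution_toC stP.
by rewrite !mxE -rmorphM lecR le_max_ratio.
Qed.

Lemma abs_eigval_ge0 (k : nat) P : 0 <= abs_eigval k P.
Proof. by rewrite -lecR -norm_eigval normr_ge0. Qed.

(** Induction that peels off the last factor: the hypothesis is used at [P_(n+2) x], then the weight
    changes from [mu_(n+1)] to [mu_(n+2)], then [P_(n+2)] contracts. The cycle is left open at the
    last weight. *)
Lemma wvar_product (n : nat) (P : nat -> 'M[R]_m) (mu : nat -> 'cV[R]_m)
    (x : 'cV[R[i]]_m) :
  (2 <= m)%N ->
  (forall i, (1 <= i <= n.+1)%N -> stochastic (P i)) ->
  (forall i, (1 <= i <= n.+1)%N -> stationary_distribution (P i) (mu i)) ->
  (forall i, (1 <= i <= n.+1)%N -> reversible (P i) (mu i)) ->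
  wvar (toC (mu 1%N)) (toC (\prod_(1 <= i < n.+2) P i) *m x)
    <= ((\prod_(1 <= i < n.+2) abs_eigval 2 (P i)) ^+ 2
        * \prod_(2 <= i < n.+2) max_ratio (mu i.-1) (mu i))%:C%C
       * wvar (toC (mu n.+1)) x.
Proof.
move=> m2; elim: n x => [|n IHn] x stoch stat rev.
  by rewrite !big_nat1 big_geq // mulr1; apply: wvar_contraction; auto.
have leS i : (1 <= i <= n.+1)%N -> (1 <= i <= n.+2)%N.
  by case/andP=> -> /leqW.
have in1 : (1 <= n.+1 <= n.+2)%N by rewrite leqnSn.
have in2 : (1 <= n.+2 <= n.+2)%N by rewrite leqnn.
rewrite !(big_nat_recr n.+2) //= map_mxM -mulmxA.
apply: le_trans (IHn _ _ _ _) _; try by move=> i /leS; auto.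
set L := \prod_(_ <= _ < _) _; set Q := \prod_(_ <= _ < _) _.
have LQ0 : 0 <= L ^+ 2 * Q.
  rewrite mulr_ge0 ?exprn_ge0 //.
    by apply: prodr_ge0 => i _; apply: abs_eigval_ge0.
  by apply: prodr_ge0 => i _; apply: max_ratio_ge0.
have r0 := max_ratio_ge0 (mu n.+1) (mu n.+2).
have st1 := stat _ in1; have st2 := stat _ in2.
apply: le_trans (ler_wpM2l _ (wvar_max_ratio _ st1 st2)) _.
  by rewrite lecR.
rewrite [leLHS]mulrA -(rmorphM (real_complex R)) /=.
have contr := wvar_contraction x m2 (stoch _ in2) st2 (rev _ in2).
apply: le_trans (ler_wpM2l _ contr) _.
  by rewrite lecR mulr_ge0.
rewrite [leLHS]mulrA -(rmorphM (real_complex R)) /= le_eqVlt; apply/orP; left; apply/eqP.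
by congr (_%:C%C * _); ring.
Qed.

End Product.

Theorem proposition8 (R : realType) (m n : nat)
    (P : nat -> 'M[R]_m) (mu : nat -> 'cV[R]_m)
    (hm : (2 <= m)%N) (hn : (1 <= n)%N)
    (hP : forall i, (1 <= i <= n)%N -> stochastic (P i))
    (hmu : forall i, (1 <= i <= n)%N -> stationary_distribution (P i) (mu i))
    (hrev : forall i, (1 <= i <= n)%N -> reversible (P i) (mu i)) :
  abs_eigval 2 (\prod_(1 <= i < n.+1) P i)
    <= (\prod_(1 <= i < n.+1) abs_eigval 2 (P i))
       * (\prod_(2 <= i < n.+1) max_ratio (mu i.-1) (mu i))
       * max_ratio (mu n) (mu 1%N).
Proof.
case: n hn hP hmu hrev => // n _ stoch stat rev.
set A := \prod_(_ <= _ < _) P _.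
set L := \prod_(_ <= _ < _) _; set Q := \prod_(_ <= _ < _) _.
set q := max_ratio _ _.
have in1 : (1 <= 1 <= n.+1)%N by [].
have inn : (1 <= n.+1 <= n.+1)%N by rewrite leqnn.
have ratio_ge1 i j : (1 <= i <= n.+1)%N -> (1 <= j <= n.+1)%N ->
    1 <= max_ratio (mu i) (mu j).
  by move=> /stat[_ ? _] /stat[? ? _]; apply: max_ratio_ge1.
have L0 : 0 <= L by apply: prodr_ge0 => i _; apply: abs_eigval_ge0.
have Q1 : 1 <= Q.
  rewrite /Q big_nat_cond; apply: (big_ind (fun x => 1 <= x)) => //.
    by move=> x y; apply: mulr_ege1.
  (* The range starts at 2, so [i.-1] is still a valid index. *)
  move=> [|[|i]] //; rewrite andbT ltnS => /andP[_ le_i].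
  by apply: ratio_ge1 => //=; apply: ltnW.
have q1 : 1 <= q by apply: ratio_ge1.
have Qq1 : 1 <= Q * q by apply: mulr_ege1.
have dmu := positive_distribution_toC (stat _ in1).
have A1 : A *m const_mx 1 = const_mx 1 :> 'cV[R]_m.
  rewrite /A big_nat_cond.
  apply: (big_ind (fun B : 'M_m => B *m const_mx 1 = const_mx 1 :> 'cV[R]_m)).
  - exact: mul1mx.
  - by move=> B B' B1 B'1; rewrite -mulmxA B'1.
  move=> i; rewrite andbT => /stoch[_ P1]; apply/colP => j.
  by rewrite !mxE -[RHS](P1 j); apply: eq_bigr => l _; rewrite mxE mulr1.
have A1C : toC A *m const_mx 1 = const_mx 1 :> 'cV_m.
  by rewrite -(rmorph1 (real_complex R)) -map_const_mx -map_mxM A1.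
have K0 : 0 <= L * Q * q by rewrite -mulrA mulr_ge0 // (le_trans ler01).
rewrite -lecR -norm_eigval.
(* The deflating row [mu 1] has mass 1 but is in general not stationary for [A]. *)
apply: (@norm_eigval2_le _ _ _ (const_mx 1) (toC (mu 1%N))^T) => // [|b].
  have [_ w1] := dmu.
  by rewrite mxE -[RHS]w1; apply: eq_bigr => j _; rewrite !mxE mulr1.
apply: deflated_eigenvalue_wvar => // [|x]; first by rewrite lecR.
apply: le_trans (wvar_product x hm stoch stat rev) _.
have LQ0 : 0 <= L ^+ 2 * Q by rewrite mulr_ge0 ?exprn_ge0 // (le_trans ler01).
(* The factor [q] closes the cycle, from [mu n.+1] back to [mu 1]. *)
apply: le_trans (ler_wpM2l _ (wvar_max_ratio x (stat _ inn) (stat _ in1))) _.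
  by rewrite lecR.
rewrite [leLHS]mulrA -(rmorphM (real_complex R)) -(rmorphXn (real_complex R)) /=.
apply: ler_wpM2r.
  by apply: wvar_ge0; have [] := dmu.
(* What remains is [L^2 (Q q) <= L^2 (Q q)^2], by [1 <= Q q]. *)
rewrite lecR -/L -/Q -/q -[leLHS]mulrA -[L * Q * q]mulrA exprMn.
apply: ler_wpM2l; first by rewrite exprn_ge0.
by rewrite expr2 ler_peMl // (le_trans ler01).
Qed.
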